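(* Let $s$ be a Sturmian word with slope $\alpha$. Then $s$ is prefix normal if and only if $s = 1c_{\alpha}$, where $c_{\alpha}$ is the characteristic word with slope $\alpha$.
   Context: Binary words are indexed from $1$. For a (finite or infinite) binary word $w$, $P_w(i)$ denotes the number of $1$s in the prefix of length $i$ of $w$. $w$ is (1-)prefix normal if for every $i\ge 1$ (with $i\le |w|$ if $w$ is finite), every factor (contiguous subword) of $w$ of length $i$ has at most $P_w(i)$ ones. A binary word is balanced if any two factors of the same length differ in their number of $1$s by at most $1$. An infinite binary word is Sturmian if it is balanced and not ultimately periodic (i.e. not of the form $vu^\omega$ with $u$ nonempty). The slope of an infinite word $w$ is $\lim_{i\to\infty}P_w(i)/i$ (this limit exists for Sturmian words and is irrational). For irrational $\alpha\in(0,1)$, the characteristic word $c_\alpha$ is the infinite word with $c_\alpha(n)=\lfloor \alpha(n+1)\rfloor-\lfloor \alpha n\rfloor$ for $n\ge 1$. *)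

(* Defs.v *)
From mathcomp Require Import all_boot all_order all_algebra.
From mathcomp Require Import boolp classical_sets functions reals topology.
From mathcomp Require Import normedtype sequences.

Set Implicit Arguments.
Unset Strict Implicit.
Unset Printing Implicit Defensive.

Import Order.TTheory GRing.Theory Num.Theory.
Import numFieldNormedType.Exports.

Local Open Scope classical_set_scope.
Local Open Scope ring_scope.

(* Mathematically words are indexed from 1: the n-th letter of w, n >= 1, is
   w n.-1; the letter 1 is true and the letter 0 is false. *)
Definition infword := nat -> bool.

Definition ones (u : seq bool) : nat := count id u.

Definition factor_at (w : infword) (k i : nat) : seq bool :=
  [seq w j | j <- iota k i].

Definition is_factor (u : seq bool) (w : infword) : Prop :=
  exists k : nat, u = factor_at w k (size u).

Definition prefix_ones (w : infword) (i : nat) : nat := ones (factor_at w 0 i).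

Definition prefix_normal (w : infword) : Prop :=
  forall i : nat, (1 <= i)%N ->
  forall u : seq bool, is_factor u w -> size u = i ->
    (ones u <= prefix_ones w i)%N.

(* The two factors play symmetric roles, so this bounds the absolute value of
   the difference. *)
Definition balanced (w : infword) : Prop :=
  forall u v : seq bool, is_factor u w -> is_factor v w -> size u = size v ->
    (ones u <= (ones v).+1)%N.

Definition word_cat (v : seq bool) (w : infword) : infword :=
  fun n => if (n < size v)%N then nth false v n else w (n - size v)%N.

Definition omega_power (u : seq bool) : infword :=
  fun n => nth false u (n %% size u)%N.

Definition ultimately_periodic (w : infword) : Prop :=
  exists v u : seq bool, u <> [::] /\ w = word_cat v (omega_power u).

Definition sturmian (w : infword) : Prop :=
  balanced w /\ ~ ultimately_periodic w.

(* The term of index i = 0 is 0 / 0 = 0 and does not affect the limit. *)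
Definition has_slope (R : realType) (w : infword) (alpha : R) : Prop :=
  (prefix_ones w i)%:R / i%:R @[i --> \oo] --> alpha.

(* The letter in 1-based position m = n.+1 is
   floor (alpha * (m + 1)) - floor (alpha * m), which is 0 or 1 when
   0 < alpha < 1. *)
Definition characteristic_word (R : realType) (alpha : R) : infword :=
  fun n => Num.floor (alpha * n.+2%:R) - Num.floor (alpha * n.+1%:R) == 1.

(* Main.v *)
Require Import Defs.
From mathcomp Require Import all_boot all_order all_algebra.
From mathcomp Require Import boolp classical_sets functions reals topology.
From mathcomp Require Import normedtype sequences.
From mathcomp Require Import zify lra.

(** Write P i for the number of ones in the prefix of length i. Cutting a
    prefix of length n * i into n blocks of length i shows that a uniform bound
    on the number of ones of the factors of length i also bounds alpha * i.
    For a balanced word this puts every factor of length i within 1 of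
    alpha * i. The word 1c_alpha has P i = floor (alpha * i) + 1, which is hence
    the largest possible value. Conversely a prefix normal word satisfies
    alpha * i <= P i <= alpha * i + 1, so it is enough to exclude
    alpha * i = P i. In that case P k - alpha * k is nonincreasing along each
    residue class mod i, drops by integers, and stays in [0, 1]; it is thus
    ultimately constant, and the word has ultimate period i. *)

Set Implicit Arguments.
Unset Strict Implicit.
Unset Printing Implicit Defensive.

Import Order.TTheory GRing.Theory Num.Theory.
Import numFieldNormedType.Exports.

Local Open Scope ring_scope.

Section Words.
Local Open Scope nat_scope.
Implicit Types (v w : infword) (i j k n : nat).

Lemma size_factor_at w k i : size (factor_at w k i) = i.
Proof. by rewrite size_map size_iota. Qed.

Lemma nth_factor_at w k i n :
  n < i -> nth false (factor_at w k i) n = w (k + n).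
Proof. by move=> n_lt; rewrite (nth_map 0) ?size_iota // nth_iota. Qed.

Lemma factor_at_is_factor w k i : is_factor (factor_at w k i) w.
Proof. by exists k; rewrite size_factor_at. Qed.

Lemma prefix_onesD w k i :
  prefix_ones w (k + i) = prefix_ones w k + ones (factor_at w k i).
Proof. by rewrite /prefix_ones /ones /factor_at iotaD map_cat count_cat. Qed.

Lemma prefix_onesS w n : prefix_ones w n.+1 = prefix_ones w n + w n.
Proof. by rewrite -addn1 prefix_onesD /ones /= addn0. Qed.

Lemma prefix_ones0 w : prefix_ones w 0 = 0.
Proof. by []. Qed.

(** Letters are differences of consecutive prefix counts. Only positive lengths are compared, as the
    closed form for [1c_alpha] covers just those. *)
Lemma prefix_ones_inj v w :
  (forall n, prefix_ones v n.+1 = prefix_ones w n.+1) -> v = w.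
Proof.
move=> eq_S; have eq_vw n : prefix_ones v n = prefix_ones w n by case: n.
apply/funext => n; have := eq_vw n.+1.
by rewrite !prefix_onesS eq_vw; case: (v n) (w n) => [] []; lia.
Qed.

Lemma ones_factor_le w k i : ones (factor_at w k i) <= i.
Proof. by rewrite -[X in _ <= X](size_factor_at w k) count_size. Qed.

Lemma prefix_normalE w :
  prefix_normal w <->
  forall k i, ones (factor_at w k i) <= prefix_ones w i.
Proof.
split=> [nw k [|i] //|nw i _ u [k ->]].
  by apply: nw; rewrite ?size_factor_at //; exact: factor_at_is_factor.
by rewrite size_factor_at => ->.
Qed.

Lemma balanced_factor_at w k l i :
  balanced w -> ones (factor_at w k i) <= (ones (factor_at w l i)).+1.
Proof.
by move=> bw; apply: bw; rewrite ?size_factor_at //; exact: factor_at_is_factor.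
Qed.

Lemma prefix_ones_mul_le w k c i n :
  (forall l, ones (factor_at w l i) <= c) ->
  prefix_ones w (k + n * i) <= prefix_ones w k + n * c.
Proof.
move=> le_c; elim: n => [|n IHn]; first by rewrite !mul0n !addn0.
rewrite !mulSnr !addnA prefix_onesD; exact: leq_add.
Qed.

Lemma prefix_ones_mul_ge w c i n :
  (forall l, c <= ones (factor_at w l i)) -> n * c <= prefix_ones w (n * i).
Proof.
move=> ge_c; elim: n => [|n IHn] //.
rewrite !mulSnr prefix_onesD; exact: leq_add.
Qed.

Lemma eventually_periodic w N j :
  0 < j -> (forall k, N <= k -> w (k + j) = w k) -> ultimately_periodic w.
Proof.
move=> j_gt0 perw; exists (factor_at w 0 N), (factor_at w N j); split.
  by move/(congr1 size); rewrite size_factor_at => j0; rewrite j0 in j_gt0.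
apply/funext => n; rewrite /word_cat /omega_power !size_factor_at.
case: ltnP => [n_lt|N_le]; first by rewrite nth_factor_at.
rewrite nth_factor_at ?ltn_mod //.
have perwm m r : w (N + r + m * j) = w (N + r).
  elim: m => [|m IHm]; first by rewrite mul0n addn0.
  by rewrite mulSnr addnA perw // -addnA leq_addr.
by rewrite -(perwm ((n - N) %/ j)) -addnA [_ %% _ + _]addnC -divn_eq subnKC.
Qed.

(** The hypothesis leaves at most one element of [B] in each residue class mod [j], so [B] is
    finite. *)
Lemma finitely_many_per_residue (B : nat -> Prop) j :
  0 < j -> (forall k n, B k -> ~ B (k + j + n * j)) ->
  exists N, forall k, N <= k -> ~ B k.
Proof.
move=> j_gt0 sparse.
have bound r : exists N, forall n, N <= n -> ~ B (r + n * j).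
  have [[m Bm]|noB] := pselect (exists m, B (r + m * j)).
    exists m.+1 => n m_lt; have := sparse _ (n - m.+1) Bm.
    by rewrite -(addnA r) -mulSnr -addnA -mulnDl subnKC.
  by exists 0 => n _ Bn; apply: noB; exists n.
have [N NP] := choice bound.
(* The bounds [N r] concern the quotient [k %/ j], hence the factor [j]. *)
exists (j * (\max_(r < j) N r)) => k k_ge.
rewrite (divn_eq k j) addnC; apply: NP.
apply: (@leq_trans (\max_(r < j) N r)).
  exact: (leq_bigmax (Ordinal (ltn_pmod k j_gt0))).
by rewrite leq_divRL // mulnC.
Qed.

End Words.

Section Slope.
Variables (R : realType) (w : infword) (alpha : R).
Hypothesis w_slope : has_slope w alpha.

Lemma slope_mul_le (i c : nat) :
  (forall n, (prefix_ones w (n * i) <= n * c)%N) -> alpha * i%:R <= c%:R.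
Proof.
case: i => [|i] le_c; first by rewrite mulr0.
rewrite -ler_pdivlMr ?ltr0n // leNgt; apply/negP => lt_alpha.
have [N _ lt_N] := cvgr_gt alpha w_slope _ lt_alpha.
(* A nonzero multiple of the block length beyond [N], where the ratio is at most [c / i.+1]. *)
have /lt_N /= : (N <= N.+1 * i.+1)%N by lia.
rewrite ltr_pdivlMr ?ltr0n ?muln_gt0 // natrM mulrCA divfK ?pnatr_eq0 //.
by rewrite -natrM ltr_nat ltnNge le_c.
Qed.

Lemma slope_mul_ge (i c : nat) :
  (forall n, (n * c <= prefix_ones w (n * i))%N) -> c%:R <= alpha * i%:R.
Proof.
case: i => [|i] ge_c.
  by have := ge_c 1%N; rewrite mul1n muln0 prefix_ones0 leqn0 => /eqP ->;
  rewrite mulr0.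
rewrite -ler_pdivrMr ?ltr0n // leNgt; apply/negP => lt_alpha.
have [N _ lt_N] := cvgr_lt alpha w_slope _ lt_alpha.
have /lt_N /= : (N <= N.+1 * i.+1)%N by lia.
rewrite ltr_pdivrMr ?ltr0n ?muln_gt0 // natrM mulrCA divfK ?pnatr_eq0 //.
by rewrite -natrM ltr_nat ltnNge ge_c.
Qed.

Lemma slope_ge0 : 0 <= alpha.
Proof. by have := @slope_mul_ge 1 0; rewrite mulr1; apply=> n; rewrite muln0. Qed.

Lemma slope_le1 : alpha <= 1.
Proof.
have := @slope_mul_le 1 1; rewrite mulr1; apply=> n.
exact: ones_factor_le.
Qed.

(** By balance, every factor of length [i] has at least one less than the count of the given one;
    the block argument bounds this by [alpha * i]. *)
Lemma balanced_ones_le (k i : nat) :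
  balanced w -> (ones (factor_at w k i))%:R <= alpha * i%:R + 1.
Proof.
move=> bw.
have : (ones (factor_at w k i)).-1%:R <= alpha * i%:R.
  apply: slope_mul_ge => n; apply: prefix_ones_mul_ge => l.
  by have := balanced_factor_at k l i bw; case: (ones _).
by case: (ones _) => [|m] /=; rewrite -?natr1; lra.
Qed.

Lemma prefix_normal_ge (i : nat) :
  prefix_normal w -> alpha * i%:R <= (prefix_ones w i)%:R.
Proof.
move=> /prefix_normalE nw; apply: slope_mul_le => n.
by have := prefix_ones_mul_le 0 n (nw^~ i); rewrite add0n prefix_ones0 add0n.
Qed.

Lemma sturmian_prefix_normal_gt (i : nat) :
  sturmian w -> prefix_normal w -> (0 < i)%N ->
  alpha * i%:R < (prefix_ones w i)%:R.
Proof.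
move=> [bw aperiodic] nw i_gt0; rewrite lt_neqAle prefix_normal_ge // andbT.
apply/negP => /eqP eq_i; apply: aperiodic.
move: (nw) => /prefix_normalE factor_le.
(* Light positions are those where [P k - alpha * k] drops on passing from [k] to [k + i]. *)
pose light k := (ones (factor_at w k i) < prefix_ones w i)%N.
have [k n|N heavy] := @finitely_many_per_residue light i i_gt0.
  rewrite /light => light_k light_l; set l := (k + i + n * i)%N in light_l.
  have Pl := prefix_ones_mul_le (k + i) n (factor_le^~ i).
  have Pk := prefix_onesD w k i.
  have Pli := prefix_onesD w l i.
  (* The blocks at [k] and [l] lose at least one each. Starting from at most [alpha * k + 1], a loss
     of 2 puts [P (l + i)] below [alpha * (l + i)]. *)
  have ub : (prefix_ones w (l + i) + 2
             <= prefix_ones w k + (n + 2) * prefix_ones w i)%N.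
    by rewrite -/l in Pl; lia.
  have := prefix_normal_ge (l + i) nw.
  have := balanced_ones_le 0 k bw; rewrite -/(prefix_ones w k).
  move: ub; rewrite -(ler_nat R) !natrD !natrM -eq_i.
  rewrite /l; nra.
have eqk k : (N <= k)%N -> ones (factor_at w k i) = prefix_ones w i.
  move=> /heavy /negP; rewrite -leqNgt => ge_i.
  by apply/eqP; rewrite eqn_leq factor_le.
apply: (@eventually_periodic w N i) => // k N_le.
(* The windows at [k] and [k.+1] have equally many ones, so the letter leaving equals the letter
   entering. *)
have := prefix_onesD w k.+1 i; rewrite addSn !prefix_onesS prefix_onesD.
rewrite !eqk ?(leqW N_le) //; case: (w (k + i)%N) (w k) => [] [] //; lia.
Qed.

End Slope.

Lemma prefix_ones_characteristic (R : realType) (alpha : R) (n : nat) :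
  0 <= alpha < 1 ->
  (prefix_ones (word_cat [:: true] (characteristic_word alpha)) n.+1)%:Z
  = Num.floor (alpha * n.+1%:R) + 1.
Proof.
move=> /andP[a_ge0 a_lt1]; elim: n => [|n IHn].
  by rewrite mulr1 (_ : Num.floor alpha = 0) //; apply/floor_def; lra.
rewrite prefix_onesS PoszD IHn /word_cat /= subn1 /= /characteristic_word.
(* The floor grows by 0 or 1, so the letter equals the increment and the sum telescopes. *)
have le_f : Num.floor (alpha * n.+1%:R) <= Num.floor (alpha * n.+2%:R).
  by apply: le_floor; rewrite ler_wpM2l // ler_nat.
have lt_f : Num.floor (alpha * n.+2%:R) < Num.floor (alpha * n.+1%:R) + 2.
  rewrite floor_lt_int -[n.+2%:R]natr1 mulrDr mulr1.
  have := floorD1_gt (alpha * n.+1%:R); rewrite !intrD; lra.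
by case: eqP => /=; lia.
Qed.

Theorem theorem2 (R : realType) (s : infword) (alpha : R)
  (s_sturmian : sturmian s) (s_slope : has_slope s alpha) :
  prefix_normal s <-> s = word_cat [:: true] (characteristic_word alpha).
Proof.
have [bs aperiodic] := s_sturmian.
have a_ge0 := slope_ge0 s_slope.
split=> [ns|s_eq].
  have a_lt1 : alpha < 1.
    have := sturmian_prefix_normal_gt s_slope s_sturmian ns (ltn0Sn 0).
    rewrite mulr1 => /lt_le_trans; apply.
    by rewrite lern1; exact: ones_factor_le.
  apply: prefix_ones_inj => n; apply/eqP; rewrite -eqz_nat; apply/eqP.
  rewrite prefix_ones_characteristic ?a_ge0 //.
  (* The strict lower bound on [P] gives the upper floor inequality, and balance gives the lower
     one. *)
  rewrite (@floor_def _ _ ((prefix_ones s n.+1)%:Z - 1)) ?subrK //.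
  have := sturmian_prefix_normal_gt s_slope s_sturmian ns (ltn0Sn n).
  have := balanced_ones_le s_slope 0 n.+1 bs; rewrite -/(prefix_ones s n.+1).
  by rewrite intrB -!pmulrn; lra.
apply/prefix_normalE => k [|i] //.
have [a_lt1|a_ge1] := ltP alpha 1.
  rewrite -lez_nat [in X in _ <= X]s_eq prefix_ones_characteristic ?a_ge0 //.
  rewrite -lerBlDr floor_ge_int intrB.
  by have := balanced_ones_le s_slope k i.+1 bs; rewrite -pmulrn; lra.
(* At slope 1 the formula yields the all-ones word, which is periodic. *)
have a1 : alpha = 1 by apply/eqP; rewrite eq_le a_ge1 (slope_le1 s_slope).
case: aperiodic; apply: (@eventually_periodic s 0 1) => // m _.
have s_true n : s n.
  rewrite s_eq /word_cat; case: n => //= n; rewrite /characteristic_word a1.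
  by rewrite !mul1r !pmulrn !intrKfloor; lia.
by rewrite !s_true.
Qed.
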